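(* Let $n>r\ge 0$ be integers, and suppose that $df\equiv A=\begin{pmatrix} A_{11} & A_{12} \\ A_{21} & A_{22} \end{pmatrix}$ and $B=\begin{pmatrix} 0 & 0 \\ 0 & B_{22} \end{pmatrix}$ are both constant, with $A_{11}\in M_r(\mathbb R)$, $B_{22}\in M_{n-r}(\mathbb R)$, and that assumptions (a)–(c) of the context hold. Let $U_0=(U_{0I},U_{0II})\in\mathbb R^r\times\mathbb R^{n-r}$ and $U_{1II}\in\mathbb R^{n-r}$. Then the steady problem $$ AU'=(BU')'\ \ (0<x<1),\qquad U(0)=U_0,\qquad U_{II}(1)=U_{1II}$$ has a unique solution if and only if $$\sigma\big(B_{22}^{-1}(A_{22}-A_{21}A_{11}^{-1}A_{12})\big)\cap \big(2i\pi\mathbb Z\setminus\{0\}\big)=\emptyset .$$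
   Context: States are $U=(U_I,U_{II})\in\mathbb R^r\times\mathbb R^{n-r}$. The steady problem is that of $\partial_t f^0(U)+f(U)_x=(B(U)U_x)_x$, where $df^0=\begin{pmatrix} \mathrm{Id}_r & 0 \\ A^0_{21} & A^0_{22} \end{pmatrix}$ is invertible with $\det A^0_{22}>0$. Assumptions: (a) $f$ and $B$ are smooth. (b) The eigenvalues of $(A^0_{22})^{-1}B_{22}+((A^0_{22})^{-1}B_{22})^T$ are positive (in particular $B_{22}$ is invertible). (c) The eigenvalues of $A_{11}$ are real and positive (in particular $A_{11}$ is invertible). $\sigma$ denotes the (complex) spectrum of a matrix. *)

(* Defs.v *)
From HB Require Import structures.
From mathcomp Require Import all_boot all_order all_algebra.
From mathcomp Require Import all_classical all_reals all_analysis.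
From mathcomp Require Import complex.

Set Implicit Arguments.
Unset Strict Implicit.
Unset Printing Implicit Defensive.

Import Order.TTheory GRing.Theory Num.Theory.
Import numFieldNormedType.Exports.

Local Open Scope ring_scope.
Local Open Scope complex_scope.
Local Open Scope classical_set_scope.

Definition iter_derive (R : realType) (V W : normedModType R) (F : V -> W)
    (vs : seq V) : V -> W :=
  foldr (fun v G => 'D_v G) F vs.

(* C^oo between finite-dimensional spaces: the iterated directional derivatives
   of all orders exist and are continuous (vs = [::] gives F itself). *)
Definition smooth (R : realType) (V W : normedModType R) (F : V -> W) : Prop :=
  forall vs : seq V, continuous (iter_derive F vs) /\
    forall x v, derivable (iter_derive F vs) x v.

Definition spectrum (R : realType) (m : nat) (M : 'M[R]_m) : set R[i] :=
  [set z | eigenvalue (map_mx (real_complex R) M) z].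

(* In the partial order of R[i], 0 < z means that z is real and positive. *)
Definition positive_spectrum (R : realType) (m : nat) (M : 'M[R]_m) : Prop :=
  spectrum M `<=` [set z | 0 < z].

Definition two_i_pi_Z (R : realType) : set R[i] :=
  [set 0 +i* (2 * pi * k%:~R) | k in [set: int]].

(* A classical solution of A U' = (B U')' on ]0,1[ with U(0) = U0 and
   U_II(1) = U1II: continuous up to the boundary, with the derivatives that the
   equation mentions existing on ]0,1[.  The values of U outside [0,1] are
   irrelevant. *)
Definition steady_solution (R : realType) (r m : nat) (A B : 'M[R]_(r + m))
    (U0 : 'cV[R]_(r + m)) (U1II : 'cV[R]_m) (U : R -> 'cV[R]_(r + m)) : Prop :=
  let BU' := fun x => B *m derive1 U x in
  [/\ {within `[0, 1], continuous U},
      forall x : R, 0 < x < 1 -> derivable U x 1 /\ derivable BU' x 1,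
      forall x : R, 0 < x < 1 -> A *m derive1 U x = derive1 BU' x,
      U 0 = U0 &
      dsubmx (U 1) = U1II].

Definition steady_uniquely_solvable (R : realType) (r m : nat)
    (A B : 'M[R]_(r + m)) (U0 : 'cV[R]_(r + m)) (U1II : 'cV[R]_m) : Prop :=
  exists U, steady_solution A B U0 U1II U /\
    forall V, steady_solution A B U0 U1II V ->
      forall x : R, 0 <= x <= 1 -> V x = U x.

(* Main.v *)
Require Import Defs.
From HB Require Import structures.
From mathcomp Require Import all_boot all_order all_algebra.
From mathcomp Require Import all_classical all_reals all_analysis.
From mathcomp Require Import complex ring lra.

Set Implicit Arguments.
Unset Strict Implicit.
Unset Printing Implicit Defensive.

Import Order.TTheory GRing.Theory Num.Theory.
Import numFieldNormedType.Exports.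

Local Open Scope ring_scope.
Local Open Scope complex_scope.
Local Open Scope classical_set_scope.

(** With L = (-A11^-1 A12; Id) and M = B22^-1 (A22 - A21 A11^-1 A12) one has
A L = B L M, and U solves the equation exactly when U = U0 + L w with w(0) = 0
and w'' = M w'.  Hence w(x) = Phi(x) c, where Phi(x) is the integral of exp(sM)
over [0, x], and the boundary condition at x = 1 reads Phi(1) c = U1II - U0II.

If Phi(1) is singular, its kernel is stable under M, so it contains an
eigenvector v of M, for some eigenvalue z.  Since exp(M) = 1 + M Phi(1), it
fixes v, so exp z = 1; and z <> 0, as otherwise Phi(1) v = v.  Conversely, an
eigenvalue z in 2 i pi Z \ {0} with eigenvector v gives the nonzero solutions
w(x) = (exp(z x) - 1) v of the homogeneous problem. *)

(** * Calculus of matrix-valued functions of a real variable *)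

Lemma is_derive_mxP (R : realType) m n (F : R -> 'M[R]_(m, n)) (x : R) dF :
  is_derive x 1 F dF <->
  forall i j, is_derive x 1 (fun t => F t i j) (dF i j).
Proof.
split=> [[dF1 <-] i j|h].
  split; first by move/derivable_mxP: dF1.
  by rewrite derive_mx// mxE.
have dF1 : derivable F x 1 by apply/derivable_mxP => i j; case: (h i j).
split=> //; rewrite derive_mx//; apply/matrixP => i j; rewrite mxE.
by case: (h i j).
Qed.

Lemma is_derive_mulmx (R : realType) m n p (F : R -> 'M[R]_(m, n))
    (G : R -> 'M[R]_(n, p)) (x : R) dF dG :
  is_derive x 1 F dF -> is_derive x 1 G dG ->
  is_derive x 1 (fun t => F t *m G t) (dF *m G x + F x *m dG).
Proof.
move=> /is_derive_mxP hF /is_derive_mxP hG; apply/is_derive_mxP => i j.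
have -> : (fun t => (F t *m G t) i j) =
    \sum_(k < n) ((fun t => F t i k) * (fun t => G t k j)).
  by apply/funext => t; rewrite mxE fct_sumE.
apply: is_derive_eq; rewrite !mxE -big_split/=; apply: eq_bigr => k _.
by rewrite addrC /GRing.scale/= [G x k j * _]mulrC.
Qed.

Lemma is_derive_mulmxl (R : realType) m n p (A : 'M[R]_(m, n))
    (G : R -> 'M[R]_(n, p)) (x : R) dG :
  is_derive x 1 G dG -> is_derive x 1 (fun t => A *m G t) (A *m dG).
Proof.
move=> hG; have := is_derive_mulmx (is_derive_cst A x 1) hG.
by rewrite mul0mx add0r.
Qed.

Lemma is_derive_mulmxr (R : realType) m n p (A : 'M[R]_(n, p))
    (F : R -> 'M[R]_(m, n)) (x : R) dF :
  is_derive x 1 F dF -> is_derive x 1 (fun t => F t *m A) (dF *m A).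
Proof.
move=> hF; have := is_derive_mulmx hF (is_derive_cst A x 1).
by rewrite mulmx0 addr0.
Qed.

Lemma is_derive_scalemx (R : realType) m n (f : R -> R) (x df : R)
    (A : 'M[R]_(m, n)) :
  is_derive x 1 f df -> is_derive x 1 (fun t => f t *: A) (df *: A).
Proof.
move=> hf; apply/is_derive_mxP => i j.
under eq_fun do rewrite mxE mulrC.
by rewrite mxE mulrC; apply: is_deriveZ.
Qed.

Lemma is_derive_reflect (R : realType) m n (F : R -> 'M[R]_(m, n)) (x : R) dF :
  is_derive (- x) 1 F dF -> is_derive x 1 (fun t => F (- t)) (- dF).
Proof.
move=> /is_derive_mxP h; apply/is_derive_mxP => i j.
rewrite mxE -mulrN1.
exact: (@is_derive1_comp _ (fun t => F t i j) -%R x (dF i j) (-1)).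
Qed.

Lemma is_derive_continuous (R : realType) m n (F : R -> 'M[R]_(m, n)) (x : R) dF :
  is_derive x 1 F dF -> {for x, continuous F}.
Proof. by case=> h _; apply/differentiable_continuous/derivable1_diffP. Qed.

Lemma within_continuous_coord (R : realType) m n (A : set R)
    (F : R -> 'M[R]_(m, n)) i j :
  {within A, continuous F} -> {within A, continuous (fun x => F x i j)}.
Proof.
move=> cF x.
have /(_ _ (@coord_continuous _ _ _ i j _)) := cvg_comp F (fun M : 'M[R]_(m, n) => M i j) (cF x).
exact.
Qed.

(** The mean value theorem holds for scalar functions only, so it is applied entry by entry.
    Continuity on the closed segment extends constancy to the endpoints, where no derivative is
    assumed. *)
Lemma derive0_within_cst (R : realType) m n (F : R -> 'M[R]_(m, n)) (a b : R) :
  (forall x, a < x < b -> is_derive x 1 F 0) ->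
  {within `[a, b], continuous F} ->
  forall x, a <= x <= b -> F x = F a.
Proof.
move=> dF cF x /andP[ax xb]; apply/matrixP => i j.
apply/eqP; rewrite -subr_eq0; apply/eqP.
have [t||c _ ->] := @MVT_segment R (fun t => F t i j) (fun=> 0) a x ax.
- rewrite in_itv/= => /andP[at0 tx].
  have tab : a < t < b by rewrite at0 (lt_le_trans tx).
  by have /is_derive_mxP/(_ i j) := dF t tab; rewrite mxE.
- apply: (@continuous_subspaceW R R `[a, x] `[a, b] (fun t => F t i j) _
    (@within_continuous_coord _ _ _ _ _ i j cF)).
  by apply: subset_itvl; rewrite bnd_simp.
- by rewrite mul0r.
Qed.

(** This version serves functions such as U_II', about which nothing is known at the ends of the
    interval: the closed version is applied between the two points compared. *)
Lemma derive0_oo_cst (R : realType) m n (F : R -> 'M[R]_(m, n)) (a b : R) :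
  (forall x, a < x < b -> is_derive x 1 F 0) ->
  forall x y, a < x < b -> a < y < b -> F x = F y.
Proof.
move=> dF x y; wlog xy : x y / x <= y.
  move=> h xab yab; have [|/ltW] := leP x y; first by move/h; exact.
  by move/h => /(_ yab xab).
move=> /andP[ax xb] /andP[ay yb].
have sub t : x <= t <= y -> a < t < b.
  by move=> /andP[xt ty]; rewrite (lt_le_trans ax xt) (le_lt_trans ty yb).
apply/esym/(@derive0_within_cst _ _ _ F x y); last by rewrite xy lexx.
- by move=> t /andP[xt ty]; apply/dF/sub; rewrite !ltW.
- apply: continuous_in_subspaceT => t; rewrite inE/= in_itv/= => /sub/dF.
  exact: is_derive_continuous.
Qed.

Lemma derive0_cst (R : realType) m n (F : R -> 'M[R]_(m, n)) :
  (forall x : R, is_derive x 1 F 0) -> forall x y, F x = F y.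
Proof.
move=> dF x y; apply/matrixP => i j.
apply: (@is_derive_0_is_cst _ (fun t => F t i j)) => t.
by have /is_derive_mxP/(_ i j) := dF t; rewrite mxE.
Qed.

(** * Power series with coefficients a_k / k! *)

(** This growth makes the sum of a_k x^k / k! converge for every x. Taking [1 <= K] lets the same
    [C] and [K] serve when a zero is put in front of the sequence. *)
Definition geom_bounded (R : realType) (a : nat -> R) : Prop :=
  exists C K : R, [/\ 0 <= C, 1 <= K & forall k, `|a k| <= C * K ^+ k].

Lemma geom_boundedS (R : realType) (a : nat -> R) :
  geom_bounded a -> geom_bounded (fun k => a k.+1).
Proof.
move=> [C [K [C0 K1 aCK]]]; have K0 : 0 <= K by rewrite (le_trans _ K1).
exists (C * K), K; split; rewrite ?mulr_ge0// => k.
by rewrite -mulrA -exprS.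
Qed.

(** The terms are dominated by those of C exp(K |x|). *)
Lemma is_cvg_exp_pseries (R : realType) (a : nat -> R) (x : R) :
  geom_bounded a -> cvgn (pseries (fun k => a k / k`!%:R) x).
Proof.
move=> [C [K [C0 K1 aCK]]]; have K0 : 0 <= K by rewrite (le_trans _ K1).
apply: normed_cvg.
apply: (@series_le_cvg _ _ (C *: exp_coeff (K * `|x|))) => [n|n|n|].
- exact: normr_ge0.
- by rewrite /= mulr_ge0// exp_coeff_ge0// mulr_ge0.
- have -> : (C *: exp_coeff (K * `|x|)) n = C * ((K * `|x|) ^+ n / n`!%:R) by [].
  rewrite /= !normrM normfV normr_nat normrX exprMn !mulrA [leRHS]mulrAC.
  by rewrite ler_wpM2r ?exprn_ge0// ler_wpM2r ?invr_ge0.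
- exact/is_cvg_seriesZ/is_cvg_series_exp_coeff.
Qed.

(** The exponential generating function of [a]: in this normalisation, differentiation is the shift
    of the coefficients. *)
Definition exp_series (R : realType) (a : nat -> R) (x : R) : R :=
  limn (pseries (fun k => a k / k`!%:R) x).

Lemma is_derive_exp_series (R : realType) (a : nat -> R) (x : R) :
  geom_bounded a ->
  is_derive x 1 (exp_series a) (exp_series (fun k => a k.+1) x).
Proof.
move=> ga.
have diffE (b : nat -> R) :
    pseries_diffs (fun k => b k / k`!%:R) = (fun k => b k.+1 / k`!%:R).
  apply/funext => k; rewrite /pseries_diffs factS natrM invfM.
  by rewrite mulrCA mulVKf.
have ga1 := geom_boundedS ga; have ga2 := geom_boundedS ga1.
rewrite /exp_series -diffE.
(* Termwise differentiation at [x] asks for convergence of the series and of its first two formal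
   derivatives at some point of larger modulus; any would do here. *)
apply: (@pseries_snd_diffs _ _ (`|x| + 1)).
- exact: is_cvg_exp_pseries.
- by rewrite diffE; exact: is_cvg_exp_pseries.
- by rewrite !diffE; exact: (is_cvg_exp_pseries ga2).
- by rewrite [ltRHS]ger0_norm ?addr_ge0// ltrDl.
Qed.

(** This lets a matrix product, whose entries are finite sums, pass through the limit. *)
Lemma exp_series_lin (R : realType) n (c : 'I_n -> R) (a : 'I_n -> nat -> R) (x : R) :
  (forall l, geom_bounded (a l)) ->
  exp_series (fun k => \sum_l c l * a l k) x = \sum_l c l * exp_series (a l) x.
Proof.
move=> ga; apply/cvg_lim => //.
rewrite (_ : pseries _ x =
    (fun N => \sum_l c l * pseries (fun k => a l k / k`!%:R) x N)).
  apply: cvg_big => [|l _]; first exact: add_continuous.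
  by apply: cvgMr; exact: is_cvg_exp_pseries.
apply/funext => N; rewrite /pseries /series/=.
under eq_bigr do rewrite !mulr_suml.
rewrite exchange_big/=; apply: eq_bigr => l _.
by rewrite mulr_sumr; apply: eq_bigr => k _; rewrite !mulrA.
Qed.

Lemma exp_series0 (R : realType) (a : nat -> R) : exp_series a 0 = a 0%N.
Proof.
(* The partial sum of index 0 is empty; the partial sums are constant only from index 1 on. *)
apply/cvg_lim => //; rewrite -(cvg_shiftS _)/=.
rewrite (_ : (fun n => _) = fun=> a 0%N); first exact: cvg_cst.
apply/funext => N; rewrite /pseries /series/= big_nat_recl//=.
rewrite fact0 expr0 divr1 mulr1 big1 ?addr0// => i _.
by rewrite expr0n/= mulr0.
Qed.

Lemma exp_series_head (R : realType) (d : R) (x : R) :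
  exp_series (fun k => if k is 0 then d else 0) x = d.
Proof.
apply/cvg_lim => //; rewrite -(cvg_shiftS _)/=.
rewrite (_ : (fun n => _) = fun=> d); first exact: cvg_cst.
apply/funext => N; rewrite /pseries /series/= big_nat_recl//=.
rewrite fact0 expr0 divr1 mulr1 big1 ?addr0// => i _.
by rewrite !mul0r.
Qed.

(** * The matrix exponential, its integral, and linear differential systems *)

(** [K] dominates every absolute row sum of [M], so each further factor [M] multiplies the bound on
    the entries by at most [K]. *)
Lemma geom_bounded_mxpow (R : realType) m (M : 'M[R]_m) i j :
  geom_bounded (fun k => (M ^+ k) i j).
Proof.
pose K := 1 + \sum_i \sum_j `|M i j|.
have sum_ge0 i' : 0 <= \sum_j `|M i' j| by apply: sumr_ge0.
have K1 : 1 <= K by rewrite lerDl sumr_ge0.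
have rowK i' : \sum_j `|M i' j| <= K.
  by rewrite /K [X in _ <= 1 + X](bigD1 i')//= addrCA lerDl addr_ge0// sumr_ge0.
exists 1, K; split=> // k; rewrite mul1r.
elim: k i => [|k IHk] i.
  by rewrite !expr0 mxE; case: (i == j); rewrite ?normr1// normr0.
rewrite exprS -mulmxE mxE (le_trans (ler_norm_sum _ _ _))//.
rewrite exprS (@le_trans _ _ (\sum_l `|M i l| * K ^+ k))//.
  by apply: ler_sum => l _; rewrite normrM ler_wpM2l.
by rewrite -mulr_suml ler_wpM2r// exprn_ge0// (le_trans _ K1).
Qed.

Lemma geom_bounded_unshift (R : realType) (a : nat -> R) :
  geom_bounded a -> geom_bounded (fun k => if k is k'.+1 then a k' else 0).
Proof.
move=> [C [K [C0 K1 aCK]]]; exists C, K; split=> // -[|k].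
  by rewrite normr0 mulr_ge0// exprn_ge0// (le_trans _ K1).
rewrite (le_trans (aCK k))// exprS ler_wpM2l// ler_peMl//.
by rewrite exprn_ge0// (le_trans _ K1).
Qed.

(* The integral of [s |-> exp(s M)] from [0] to [x]. *)
Definition expint (R : realType) m (M : 'M[R]_m) (x : R) : 'M[R]_m :=
  \matrix_(i, j)
    exp_series (fun k => if k is k'.+1 then (M ^+ k') i j else 0) x.

Section expint_theory.
Context {R : realType} {m : nat}.
Context (M : 'M[R]_m).

Let gM i j : geom_bounded
  (fun k => if k is k'.+1 then (M ^+ k') i j else 0).
Proof. exact/geom_bounded_unshift/geom_bounded_mxpow. Qed.

Lemma expint0 : expint M 0 = 0.
Proof. by apply/matrixP => i j; rewrite !mxE exp_series0. Qed.

(** The factor [M] raises each power by one and keeps the zero constant term: the series is that of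
    exp(xM) - 1. Multiplication on the right gives the same series, whence [expint_comm]. *)
Lemma mulmx_expint x i j : (M *m expint M x) i j =
  exp_series (fun k => if k is k'.+1 then (M ^+ k'.+1) i j else 0) x.
Proof.
rewrite mxE; under eq_bigr do rewrite mxE.
rewrite -exp_series_lin; last by move=> l; exact: gM.
congr (exp_series _ x); apply/funext => -[|k].
  by rewrite big1// => l _; rewrite mulr0.
by rewrite exprS -mulmxE mxE.
Qed.

Lemma expint_mulmx x i j : (expint M x *m M) i j =
  exp_series (fun k => if k is k'.+1 then (M ^+ k'.+1) i j else 0) x.
Proof.
rewrite mxE; under eq_bigr do rewrite mxE mulrC.
rewrite -exp_series_lin; last by move=> l; exact: gM.
congr (exp_series _ x); apply/funext => -[|k].
  by rewrite big1// => l _; rewrite mulr0.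
by rewrite exprSr -mulmxE mxE; apply: eq_bigr => l _; rewrite mulrC.
Qed.

Lemma expint_comm x : M *m expint M x = expint M x *m M.
Proof. by apply/matrixP => i j; rewrite mulmx_expint expint_mulmx. Qed.

Lemma is_derive_expint (x : R) :
  is_derive x 1 (expint M) (1%:M + M *m expint M x).
Proof.
apply/is_derive_mxP => i j; rewrite [X in is_derive _ _ _ X]mxE mulmx_expint.
have -> : (fun t => expint M t i j) =
    exp_series (fun k => if k is k'.+1 then (M ^+ k') i j else 0).
  by apply/funext => t; rewrite mxE.
apply: is_derive_eq; first exact: is_derive_exp_series.
(* The shifted series has coefficients M^k for all k >= 0. It is split as a combination of two
   series: the term k = 0, which gives the identity, and the rest, which is [M *m expint M x]. *)
pose c := fun l : 'I_2 => 1 : R.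
pose a := fun (l : 'I_2) k => if l == 0 then
   (if k is 0%N then (1%:M : 'M[R]_m) i j else 0) else
   (if k is k'.+1 then (M ^+ k'.+1) i j else 0).
have := @exp_series_lin R 2 c a x.
rewrite !big_ord_recl !big_ord0/= /c /a !mul1r !addr0 exp_series_head => <-.
  congr (exp_series _ x); apply/funext => k.
  rewrite !big_ord_recl big_ord0 !mul1r addr0.
  by case: k => [|k]; rewrite ?expr0 ?addr0 ?add0r.
move=> l; case: (l == 0).
  exists `|(1%:M : 'M[R]_m) i j|, 1; split=> // -[|k]; rewrite expr1n mulr1//.
  by rewrite normr0.
apply: geom_bounded_unshift; apply: (@geom_boundedS _ (fun k => (M ^+ k) i j)).
exact: geom_bounded_mxpow.
Qed.

(** This is exp(xM), recovered from its integral by the fundamental theorem of calculus. *)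
Definition expmx (x : R) : 'M[R]_m := 1%:M + M *m expint M x.

Lemma expmx0 : expmx 0 = 1%:M.
Proof. by rewrite /expmx expint0 mulmx0 addr0. Qed.

Lemma expmx_comm x : M *m expmx x = expmx x *m M.
Proof.
by rewrite /expmx mulmxDr mulmxDl mulmx1 mul1mx expint_comm mulmxA expint_comm.
Qed.

Lemma is_derive_expmx (x : R) : is_derive x 1 expmx (M *m expmx x).
Proof.
have := is_deriveD (is_derive_cst (1%:M : 'M[R]_m) x 1)
  (is_derive_mulmxl M (is_derive_expint x)).
by rewrite add0r.
Qed.

Lemma is_derive_expmxN (x : R) :
  is_derive x 1 (fun t => expmx (- t)) (- (M *m expmx (- x))).
Proof. exact/is_derive_reflect/is_derive_expmx. Qed.

(** The derivative of the product vanishes because [M] commutes with its exponential; the value is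
    read at 0. *)
Lemma expmxNK x : expmx (- x) *m expmx x = 1%:M.
Proof.
rewrite (@derive0_cst _ _ _ (fun t => expmx (- t) *m expmx t) _ x 0).
  by rewrite oppr0 expmx0 mulmx1.
move=> t; have := is_derive_mulmx (is_derive_expmxN t) (is_derive_expmx t).
by rewrite mulNmx expmx_comm mulmxA addNr.
Qed.

Lemma expmxKN x : expmx x *m expmx (- x) = 1%:M.
Proof. by have := expmxNK (- x); rewrite opprK. Qed.

Lemma linear_ode_col n (z : R -> 'M[R]_(m, n)) :
  (forall x : R, 0 < x < 1 -> is_derive x 1 z (M *m z x)) ->
  exists c, forall x, 0 < x < 1 -> z x = expmx x *m c.
Proof.
(* The function exp(-tM) z(t) is constant. Its value is taken at the midpoint, since [z] is
   controlled on the open interval only. *)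
move=> dz; exists (expmx (- (2^-1)) *m z 2^-1) => x x01.
have half01 : 0 < (2^-1 : R) < 1 by apply/andP; split; lra.
rewrite (@derive0_oo_cst _ _ _ (fun t => expmx (- t) *m z t) 0 1 _ 2^-1 x)//.
  by rewrite mulmxA expmxKN mul1mx.
move=> t t01; have := is_derive_mulmx (is_derive_expmxN t) (dz t t01).
by rewrite mulNmx expmx_comm mulmxA addNr.
Qed.

Lemma linear_ode_row n (z : R -> 'M[R]_(n, m)) :
  (forall x : R, is_derive x 1 z (z x *m M)) ->
  forall x, z x = z 0 *m expmx x.
Proof.
move=> dz x.
have zE : z x *m expmx (- x) = z 0 *m expmx (- 0).
  apply: (@derive0_cst _ _ _ (fun t => z t *m expmx (- t))) => t.
  have := is_derive_mulmx (dz t) (is_derive_expmxN t).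
  by rewrite mulmxN mulmxA subrr.
by rewrite -[LHS]mulmx1 -(expmxNK x) mulmxA zE oppr0 expmx0 mulmx1.
Qed.

End expint_theory.

(** * Periods of cosine, and the exponential on a complex eigenvector *)

Lemma cos_sin_2piM (R : realType) (k : int) :
  cos (2 * pi * k%:~R : R) = 1 /\ sin (2 * pi * k%:~R : R) = 0.
Proof.
suff nat_case (n : nat) : cos (2 * pi * n%:R : R) = 1 /\ sin (2 * pi * n%:R : R) = 0.
  case: k => n; first exact: nat_case.
  have [cn sn] := nat_case n.+1.
  by rewrite NegzE mulrNz mulrN cosN sinN cn sn oppr0.
elim: n => [|n [cn sn]]; first by rewrite mulr0 cos0 sin0.
have -> : 2 * pi * n.+1%:R = 2 * pi * n%:R + pi *+ 2 :> R.
  by rewrite -[n.+1%:R]natr1; ring.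
by rewrite cosD2pi sinD2pi.
Qed.

(** Reduce x modulo 2 pi to y in [0, 2 pi[. Then cos y = 1 - 2 sin(y/2)^2 gives sin(y/2) = 0, while
    sine is positive on ]0, pi[, so y = 0. *)
Lemma cos_eq1 (R : realType) (x : R) :
  cos x = 1 -> exists k : int, x = 2 * pi * k%:~R.
Proof.
move=> cx; have pi2 : 0 < 2 * pi :> R by rewrite mulr_gt0 ?pi_gt0.
pose k := Num.floor (x / (2 * pi)); exists k.
pose y := x - 2 * pi * k%:~R.
have /andP[kx xk] := floor_itv (x / (2 * pi)).
have y0 : 0 <= y by rewrite subr_ge0 mulrC -ler_pdivlMr.
have y2pi : y < 2 * pi.
  by rewrite ltrBlDr -{1}[2 * pi]mulr1 -mulrDr addrC mulrC -ltr_pdivrMr// -intrD1.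
have cy : cos y = 1.
  by have [ck sk] := cos_sin_2piM R k; rewrite cosB ck sk cx !mulr1 mulr0 addr0.
apply/eqP; rewrite -subr_eq0 -/y; apply/eqP.
have : cos (y / 2 *+ 2) = 1 by rewrite -mulr_natr divfK.
rewrite cos_mulr2n cos2sin2 => sy0.
have {}sy0 : sin (y / 2) = 0.
  by apply/eqP; rewrite -sqrf_eq0; apply/eqP; lra.
apply/eqP; apply: contra_eqT sy0 => yn0; rewrite gt_eqF// sin_gt0_pi//.
have : 0 < y by rewrite lt_def yn0.
by move=> ?; apply/andP; split; lra.
Qed.

Lemma is_derive_expR_cos (R : realType) (a b x : R) :
  is_derive x 1 (fun t => expR (a * t) * cos (b * t))
    (a * (expR (a * x) * cos (b * x)) - b * (expR (a * x) * sin (b * x))).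
Proof.
by apply: trigger_derive; rewrite /GRing.scale/=; ring.
Qed.

Lemma is_derive_expR_sin (R : realType) (a b x : R) :
  is_derive x 1 (fun t => expR (a * t) * sin (b * t))
    (a * (expR (a * x) * sin (b * x)) + b * (expR (a * x) * cos (b * x))).
Proof.
by apply: trigger_derive; rewrite /GRing.scale/=; ring.
Qed.

(** The hypotheses say that p + iq is a left eigenvector for a + ib. The real part of exp((a +
    ib)t)(p + iq) solves P' = PM with P(0) = p, so it equals p exp(tM) by uniqueness. *)
Lemma eigen_expmx (R : realType) m (M : 'M[R]_m) (a b : R) (p q : 'rV[R]_m) :
  p *m M = a *: p - b *: q -> q *m M = b *: p + a *: q ->
  p *m expmx M 1 = (expR a * cos b) *: p - (expR a * sin b) *: q.
Proof.
move=> pM qM.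
pose P t : 'rV[R]_m :=
  (expR (a * t) * cos (b * t)) *: p - (expR (a * t) * sin (b * t)) *: q.
have P0 : P 0 = p.
  by rewrite /P !mulr0 cos0 sin0 expR0 mulr1 mulr0 scale1r scale0r subr0.
have dP (t : R) : is_derive t 1 P (P t *m M).
  have h := is_deriveB (is_derive_scalemx p (is_derive_expR_cos a b t))
    (is_derive_scalemx q (is_derive_expR_sin a b t)).
  apply: (is_derive_eq h); rewrite /P mulmxBl -!scalemxAl pM qM.
  by apply/matrixP => i j; rewrite !mxE; ring.
by have := linear_ode_row dP 1; rewrite P0 => <-; rewrite /P !mulr1.
Qed.

(** * Complex eigenvectors and the invertibility of [expint M 1] *)

Lemma map_Re_mulmx (R : realType) m n p (v : 'M[R[i]]_(m, n)) (N : 'M[R]_(n, p)) :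
  map_mx (@complex.Re R) (v *m map_mx (real_complex R) N) =
  map_mx (@complex.Re R) v *m N.
Proof.
apply/matrixP => i j; rewrite !mxE.
rewrite (big_morph (@complex.Re R) (id1 := 0) (op1 := +%R))//; last by case=> ? ? [].
by apply: eq_bigr => k _; rewrite !mxE; case: (v i k) => x y /=; rewrite mulr0 subr0.
Qed.

Lemma map_Im_mulmx (R : realType) m n p (v : 'M[R[i]]_(m, n)) (N : 'M[R]_(n, p)) :
  map_mx (@complex.Im R) (v *m map_mx (real_complex R) N) =
  map_mx (@complex.Im R) v *m N.
Proof.
apply/matrixP => i j; rewrite !mxE.
rewrite (big_morph (@complex.Im R) (id1 := 0) (op1 := +%R))//; last by case=> ? ? [].
by apply: eq_bigr => k _; rewrite !mxE; case: (v i k) => x y /=; rewrite mulr0 add0r.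
Qed.

Lemma real_eigenpair (R : realType) m (M : 'M[R]_m) (a b : R) (v : 'rV[R[i]]_m) :
  v *m map_mx (real_complex R) M = (a +i* b) *: v ->
  let p := map_mx (@complex.Re R) v in let q := map_mx (@complex.Im R) v in
  p *m M = a *: p - b *: q /\ q *m M = b *: p + a *: q.
Proof.
move=> vM p q; rewrite /p /q -map_Re_mulmx -map_Im_mulmx vM.
by split; apply/matrixP => i j; rewrite !mxE; case: (v i j) => x y //=; rewrite addrC.
Qed.

Lemma map_ReIm_eq0 (R : realType) m n (v : 'M[R[i]]_(m, n)) :
  map_mx (@complex.Re R) v = 0 -> map_mx (@complex.Im R) v = 0 -> v = 0.
Proof.
move=> /matrixP p0 /matrixP q0; apply/matrixP => i j.
move: (p0 i j) (q0 i j); rewrite !mxE.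
by case: (v i j) => x y /= -> ->.
Qed.

Lemma comm_kernel_eigenvector (C : numClosedFieldType) m (F G : 'M[C]_m) :
  comm_mx F G -> F \notin unitmx ->
  exists (v : 'rV[C]_m) a, [/\ v != 0, v *m F = 0 & v *m G = a *: v].
Proof.
move=> FG F_sing; pose V := kermx F.
have Vst : stablemx V G by apply: comm_mx_stable_ker.
have rV : (0 < \rank V)%N by rewrite lt0n mxrank_eq0 kermx_eq0 row_free_unit.
have [a /eigenvalueP[w wG wn0]] := eigenvalue_closed (restrictmx V G) rV.
exists (w *m row_base V), a; split.
- apply: contra wn0 => /eqP w0; apply/eqP/(row_free_inj (row_base_free V)).
  by rewrite w0 mul0mx.
- by apply/sub_kermxP; rewrite (submx_trans (submxMl _ _))// eq_row_base.
- have rVG : row_base V *m G = restrictmx V G *m row_base V.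
    by rewrite /conjmx mulmxKpV// stablemx_row_base.
  by rewrite -mulmxA rVG mulmxA wG -scalemxAl.
Qed.

Lemma expint1_unit (R : realType) m (M : 'M[R]_m) :
  (forall k : int, eigenvalue (map_mx (real_complex R) M)
    (0 +i* (2 * pi * k%:~R)) -> k = 0) ->
  expint M 1 \in unitmx.
Proof.
move=> res; apply: contraT => sing; exfalso.
have sing' : map_mx (real_complex R) (expint M 1) \notin unitmx.
  by rewrite map_unitmx.
have comm' : comm_mx (map_mx (real_complex R) (expint M 1))
    (map_mx (real_complex R) M).
  by rewrite /comm_mx -!map_mxM expint_comm.
have [v [[a b] [v0 vF vM]]] := comm_kernel_eigenvector comm' sing'.
have /= [pM qM] := real_eigenpair vM.
have pF : map_mx (@complex.Re R) v *m expint M 1 = 0.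
  by rewrite -map_Re_mulmx vF; apply/matrixP => i j; rewrite !mxE.
have qF : map_mx (@complex.Im R) v *m expint M 1 = 0.
  by rewrite -map_Im_mulmx vF; apply/matrixP => i j; rewrite !mxE.
move: (@map_ReIm_eq0 _ _ _ v) pM qM pF qF.
move: (map_mx (@complex.Re R) v) (map_mx (@complex.Im R) v).
move=> p q pq0 pM qM pF qF.
have expE (w : 'rV[R]_m) : w *m expint M 1 = 0 -> w *m expmx M 1 = w.
  by move=> wF; rewrite /expmx expint_comm mulmxDr mulmx1 mulmxA wF mul0mx addr0.
have := eigen_expmx pM qM; rewrite (expE _ pF) => pE.
(* The pair (q, -p) comes from the eigenvector -i(p + iq), so [eigen_expmx] also yields the image of
   q. *)
have qM' : q *m M = a *: q - b *: (- p) by rewrite qM scalerN opprK addrC.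
have pM' : - p *m M = b *: q + a *: (- p).
  by rewrite mulNmx pM scalerN opprB.
have := eigen_expmx qM' pM'; rewrite (expE _ qF) => qE.
move: pE qE; set c := expR a * cos b; set s := expR a * sin b => pE qE.
(* With exp(a + ib) = c + is, this is |1 - exp(a + ib)|^2, the determinant of the 2 x 2 system that
   [pE] and [qE] form in p and q. Cramer's rule gives the combinations below. *)
pose d := (1 - c) ^+ 2 + s ^+ 2.
have dp : d *: p = 0.
  have /matrixP pE' := pE; have /matrixP qE' := qE.
  apply/matrixP => i j; move: (pE' i j) (qE' i j); rewrite /d !mxE => e1 e2.
  transitivity ((1 - c) * (p i j - (c * p i j - s * q i j))
    - s * (q i j - (c * q i j - s * - p i j))); first by ring.
  by rewrite -e1 -e2 !subrr !mulr0 subrr.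
have dq : d *: q = 0.
  have /matrixP pE' := pE; have /matrixP qE' := qE.
  apply/matrixP => i j; move: (pE' i j) (qE' i j); rewrite /d !mxE => e1 e2.
  transitivity (s * (p i j - (c * p i j - s * q i j))
    + (1 - c) * (q i j - (c * q i j - s * - p i j))); first by ring.
  by rewrite -e1 -e2 !subrr !mulr0 addr0.
have d0 : d = 0.
  apply/eqP; apply: contraNT v0 => dn0; apply/eqP/pq0.
    by move/eqP: dp; rewrite scaler_eq0 (negPf dn0) => /eqP.
  by move/eqP: dq; rewrite scaler_eq0 (negPf dn0) => /eqP.
have [c1 s0] : c = 1 /\ s = 0.
  move/eqP: d0; rewrite /d paddr_eq0 ?sqr_ge0// !sqrf_eq0 subr_eq0.
  by move=> /andP[/eqP <- /eqP].
(* Here exp(a)^2 = c^2 + s^2 = 1. *)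
have ea1 : expR a = 1.
  have : expR a ^+ 2 = 1.
    rewrite -[LHS]mulr1 -[X in _ * X = _](cos2Dsin2 b) mulrDr -!exprMn -/c -/s c1 s0.
    by rewrite expr0n/= addr0 expr1n.
  move/eqP; rewrite sqrf_eq1 => /orP[/eqP//|/eqP ea].
  by have := expR_gt0 a; rewrite ea ltr0N1.
have a0 : a = 0 by apply: expR_inj; rewrite ea1 expR0.
have cb1 : cos b = 1 by rewrite -c1 /c ea1 mul1r.
have [k bk] := cos_eq1 cb1.
have k0 : k = 0.
  by apply: res; rewrite -bk -a0; apply/eigenvalueP; exists v.
have b0 : b = 0 by rewrite bk k0 mulr0.
have fix0 (w : 'rV[R]_m) : w *m M = 0 -> w *m expint M 1 = 0 -> w = 0.
  move=> wM wF.
  (* If wM = 0, the derivative of w [expint M t] is w, so this difference is constant; comparing t =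
     1 with t = 0 gives w = w [expint M 1] = 0. *)
  have := @derive0_cst _ _ _ (fun t => w *m expint M t - t *: w) _ 1 0.
  rewrite wF expint0 mulmx0 scale1r scale0r subrr sub0r => /(_ _)/eqP.
  rewrite oppr_eq0 => h; apply/eqP/h => t.
  have h' := is_deriveB (is_derive_mulmxl w (is_derive_expint M t))
    (is_derive_scalemx w (is_derive_id t 1)).
  apply: (is_derive_eq h').
  by rewrite mulmxDr mulmx1 mulmxA wM mul0mx addr0 scale1r subrr.
move/eqP: v0; apply; apply: pq0; apply: fix0 => //.
  by rewrite pM a0 b0 !scale0r subrr.
by rewrite qM a0 b0 !scale0r addr0.
Qed.

(** [eigenvalue] speaks of row vectors, but a square matrix is singular exactly when its transpose
    is. Columns are what the differential equation acts on. *)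
Lemma eigenvalue_col (F : fieldType) m (A : 'M[F]_m) a :
  eigenvalue A a -> exists2 v : 'cV[F]_m, A *m v = a *: v & v != 0.
Proof.
rewrite /eigenvalue kermx_eq0 row_free_unit -unitmx_tr -row_free_unit -kermx_eq0.
rewrite linearB/= tr_scalar_mx => eigT.
have [v vA v0] := eigenvalueP (eigT : eigenvalue A^T a).
exists v^T; last by rewrite trmx_eq0.
by rewrite -[LHS]trmxK trmx_mul trmxK vA linearZ.
Qed.

Lemma real_eigencol (R : realType) m (M : 'M[R]_m) (b : R) :
  eigenvalue (map_mx (real_complex R) M) (0 +i* b) ->
  exists p q : 'cV[R]_m,
    [/\ M *m p = - b *: q, M *m q = b *: p & (p != 0) || (q != 0)].
Proof.
move=> /eigenvalue_col[v Mv v0].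
have [] := @real_eigenpair R m M^T 0 b v^T.
  by rewrite -map_trmx -trmx_mul Mv linearZ.
rewrite !scale0r sub0r addr0 -!map_trmx => /(congr1 trmx) Mp /(congr1 trmx) Mq.
exists (map_mx (@complex.Re R) v), (map_mx (@complex.Im R) v); split.
- by move: Mp; rewrite trmx_mul !trmxK linearN linearZ/= trmxK scaleNr.
- by move: Mq; rewrite trmx_mul !trmxK linearZ/= trmxK.
- apply: contraNT v0; rewrite negb_or !negbK => /andP[/eqP p0 /eqP q0].
  by apply/eqP/map_ReIm_eq0.
Qed.

(** * Invertibility from positive spectra *)

(** A real symmetric matrix is normal over the complex numbers, hence unitarily diagonalisable. With
    w the coordinates of v, the quadratic form is the sum of D_i |w_i|^2 with all D_i > 0, so it
    vanishes only if w = 0. *)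
Lemma sym_positive_spectrum_neq0 (R : realType) m (S : 'M[R]_m) (v : 'rV[R]_m) :
  S^T = S -> positive_spectrum S -> v != 0 -> v *m S *m v^T != 0.
Proof.
move=> S_sym S_pos v0.
pose Sc := map_mx (real_complex R) S; pose vc := map_mx (real_complex R) v.
have conj_real k l (N : 'M[R]_(k, l)) :
    map_mx Num.conj (map_mx (real_complex R) N) = map_mx (real_complex R) N.
  by apply/matrixP => i j; rewrite !mxE; apply: conjc_real.
have Sc_normal : Sc \is normalmx.
  by apply/normalmxP; rewrite /Sc map_trmx S_sym conj_real.
have /orthomx_spectralP := Sc_normal.
set P := spectralmx Sc; set D := spectral_diag Sc => ScE.
have P_unitary : P \is unitarymx by exact: spectral_unitarymx.
have PV : invmx P = map_mx Num.conj P^T by exact: invmx_unitary.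
have P_unit : P \in unitmx by exact: unitarymx_unit.
have delta_P i : delta_mx 0 i *m P != 0 :> 'rV_m.
  apply/eqP => /(congr1 (mulmx^~ (invmx P)))/=; rewrite mulmxK// mul0mx.
  by move=> /matrixP/(_ 0 i); rewrite !mxE !eqxx => /eqP; rewrite oner_eq0.
(* Row i of [P] is a left eigenvector for the i-th diagonal entry. *)
have D_pos i : 0 < D 0 i.
  apply: S_pos; apply/eigenvalueP; exists (delta_mx 0 i *m P) => //.
  by rewrite -/Sc ScE !mulmxA mulmxK// -[_ *m diag_mx D]rowE row_diag_mx -scalemxAl.
pose w := vc *m invmx P.
have w_adj : map_mx Num.conj w^T = P *m vc^T.
  by rewrite /w trmx_mul map_mxM [vc^T]map_trmx conj_real -map_trmx -/vc PV trmxCK.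
apply: contra v0 => /eqP vSv.
have vScv : vc *m Sc *m vc^T = 0.
  by rewrite /vc /Sc map_trmx -!map_mxM vSv map_mx0.
have wDw : w *m diag_mx D *m map_mx Num.conj w^T = 0.
  by rewrite w_adj /w !mulmxA; move: vScv; rewrite {1}ScE !mulmxA.
have {}wDw : \sum_i D 0 i * `|w 0 i| ^+ 2 = 0.
  move/matrixP/(_ 0 0): wDw; rewrite mul_mx_diag !mxE => wDw0.
  rewrite -[RHS]wDw0; apply: eq_bigr => i _; by rewrite !mxE normCK mulrA [D 0 i * _]mulrC.
have w0 i : w 0 i = 0.
  have Dw_ge0 k : true -> 0 <= D 0 k * `|w 0 k| ^+ 2.
    by move=> _; rewrite mulr_ge0 ?exprn_ge0// ltW.
  have Dw0 := psumr_eq0P Dw_ge0 wDw.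
  by move/eqP: (Dw0 i isT); rewrite mulf_eq0 gt_eqF//= sqrf_eq0 normr_eq0 => /eqP.
have vc0 : vc = 0.
  rewrite -[vc](mulmxKV P_unit) -/w.
  suff -> : w = 0 by rewrite mul0mx.
  by apply/matrixP => i j; rewrite ord1 w0 mxE.
by rewrite -(map_mx_eq0 (real_complex R)) -/vc vc0.
Qed.

(** A row v with vC = 0 would make v(C + C^T)v^T vanish. *)
Lemma sym_part_positive_unitmx (R : realType) m (C : 'M[R]_m) :
  positive_spectrum (C + C^T) -> C \in unitmx.
Proof.
move=> C_pos; apply: contraT; rewrite unitmxE unitfE negbK => /det0P[v v0 vC].
have := @sym_positive_spectrum_neq0 _ _ (C + C^T) v.
rewrite linearD/= trmxK addrC => /(_ erefl C_pos v0).
rewrite mulmxDr mulmxDl vC mul0mx add0r -mulmxA -trmx_mul vC trmx0 mulmx0.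
by rewrite eqxx.
Qed.

Lemma positive_spectrum_unitmx (R : realType) m (C : 'M[R]_m) :
  positive_spectrum C -> C \in unitmx.
Proof.
move=> C_pos; apply: contraT; rewrite unitmxE unitfE negbK => /det0P[v v0 vC].
suff C0 : spectrum C 0 by move: (C_pos _ C0 : 0 < 0); rewrite ltxx.
apply/eigenvalueP; exists (map_mx (real_complex R) v).
  by rewrite -map_mxM vC map_mx0 scale0r.
by rewrite map_mx_eq0.
Qed.

(** * Reduction of the steady problem to w'' = M w' *)

Section reduction.
Context {R : realType} {r m : nat}.
Context (A11 : 'M[R]_r) (A12 : 'M[R]_(r, m)) (A21 : 'M[R]_(m, r)).
Context (A22 B22 : 'M[R]_m).
Context (A11_unit : A11 \in unitmx) (B22_unit : B22 \in unitmx).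

Let A := block_mx A11 A12 A21 A22.
Let B := block_mx 0 0 0 B22 : 'M[R]_(r + m).
Let L := col_mx (- (invmx A11 *m A12)) 1%:M : 'M[R]_(r + m, m).
Let M := invmx B22 *m (A22 - A21 *m invmx A11 *m A12).

(** The first block row of [A] kills [L]; the second leaves the Schur complement of [A11], which is
    [B22 *m M]. *)
Lemma mul_block_lift : A *m L = B *m L *m M.
Proof.
rewrite /A /B /L !mul_block_col mulmxN mulKVmx// mulmx1 addNr.
rewrite !mul0mx !add0r !mulmx1 mul_col_mx mul0mx /M mulKVmx//.
by rewrite mulmxN !mulmxA addrC.
Qed.

Lemma steady_solution_cst (U0 : 'cV[R]_(r + m)) :
  steady_solution A B U0 (dsubmx U0) (fun=> U0).
Proof.
have BU0 : (fun x : R => B *m derive1 (fun=> U0) x) = fun=> 0.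
  by apply/funext => x; rewrite derive1_cst mulmx0.
split=> // [x|x x01|x x01]; first exact: cst_continuous.
- by split; [exact: derivable_cst | rewrite BU0; exact: derivable_cst].
- by rewrite BU0 !derive1_cst mulmx0.
Qed.

(** Superposition, with two uses: from the constant state it builds a solution, and from any
    solution it builds another one when w(1) = 0. *)
Lemma steady_solution_add (U0 : 'cV[R]_(r + m)) (U1 : 'cV[R]_m)
    (U : R -> 'cV[R]_(r + m)) (w z : R -> 'cV[R]_m) :
  (forall x : R, is_derive x 1 w (z x)) ->
  (forall x : R, is_derive x 1 z (M *m z x)) -> w 0 = 0 ->
  steady_solution A B U0 U1 U ->
  steady_solution A B U0 (U1 + w 1) (fun x => U x + L *m w x).
Proof.
move=> dw dz w0 [cU dU eqU U00 U11].
have dV (x : R) : 0 < x < 1 ->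
    is_derive x 1 (fun t => U t + L *m w t) (derive1 U x + L *m z x).
  move=> /dU[/derivableP dUx _]; rewrite derive1E.
  exact: (is_deriveD dUx (is_derive_mulmxl L (dw x))).
have dBV (x : R) : 0 < x < 1 ->
    is_derive x 1 (fun t => B *m derive1 (fun t => U t + L *m w t) t)
      (derive1 (fun t => B *m derive1 U t) x + B *m L *m (M *m z x)).
  move=> x01; have /derivableP := (dU x x01).2; rewrite -derive1E => dBU.
  have h := is_deriveD dBU (is_derive_mulmxl (B *m L) (dz x)).
  (* The formula for the derivative of the sum holds on the open interval only, thus in a
     neighbourhood of [x]. *)
  apply: near_eq_is_derive h.
  have : x \in `]0, 1[%R by rewrite in_itv/=.
  move=> /near_in_itvoo; apply: filterS => t; rewrite in_itv/= => t01.
  by rewrite [in RHS]derive1E; have [_ ->] := dV t t01; rewrite mulmxDr mulmxA.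
split.
- apply: (@within_continuousD _ R _ _ U (fun t => L *m w t)) => //.
  apply: continuous_subspaceT => t.
  exact: is_derive_continuous (is_derive_mulmxl L (dw t)).
- by move=> x x01; split; [case: (dV x x01) | case: (dBV x x01)].
- move=> x x01; rewrite [derive1 _ x]derive1E [RHS]derive1E.
  have [_ ->] := dV x x01; have [_ ->] := dBV x x01.
  by rewrite mulmxDr eqU// mulmxA mul_block_lift -(mulmxA (B *m L)).
- by rewrite w0 mulmx0 addr0.
- by rewrite linearD/= U11 mul_col_mx col_mxKd mul1mx.
Qed.

(** The first block of BV' is zero, hence so is that of AV', which expresses V_I' through z = V_II'
    and gives V' = Lz. The second block then reads z' = Mz, and integrating Lz from 0 gives the
    formula. *)
Lemma steady_solution_repr (U0 : 'cV[R]_(r + m)) (U1 : 'cV[R]_m)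
    (V : R -> 'cV[R]_(r + m)) :
  steady_solution A B U0 U1 V ->
  exists c, forall x, 0 <= x <= 1 -> V x = U0 + L *m (expint M x *m c).
Proof.
move=> [cV dV eqV V0 V1].
pose z (x : R) := dsubmx (derive1 V x).
have BVE x : B *m derive1 V x = col_mx 0 (B22 *m z x).
  by rewrite -[derive1 V x]vsubmxK mul_block_col !mul0mx !add0r.
have dBV (x : R) : 0 < x < 1 ->
    is_derive x 1 (fun t => B *m derive1 V t) (A *m derive1 V x).
  by move=> x01; have /derivableP := (dV x x01).2; rewrite -derive1E -(eqV x x01).
have upper (x : R) : 0 < x < 1 -> usubmx (A *m derive1 V x) = 0.
  move=> x01; apply/matrixP => i j; rewrite [LHS]mxE [RHS]mxE.
  have /is_derive_mxP/(_ (lshift m i) j)[_ <-] := dBV x x01.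
  rewrite (_ : (fun t => _) = fun=> 0) ?derive_cst//.
  by apply/funext => t; rewrite BVE col_mxEu mxE.
have dVE (x : R) : 0 < x < 1 -> derive1 V x = L *m z x.
  move=> x01; have := upper x x01.
  rewrite -{1}[derive1 V x]vsubmxK mul_block_col col_mxKu -/(z x).
  move=> /eqP; rewrite addr_eq0 => /eqP/(congr1 (mulmx (invmx A11))).
  rewrite mulKmx// => uE.
  by rewrite -[LHS]vsubmxK uE mul_col_mx mul1mx mulNmx mulmxN mulmxA.
have dz (x : R) : 0 < x < 1 -> is_derive x 1 z (M *m z x).
  move=> x01.
  (* A second derivative is granted for BV' only, so z is recovered from it by inverting [B22]. *)
  have zBV : z = (fun t => row_mx 0 (invmx B22) *m (B *m derive1 V t)).
    by apply/funext => t; rewrite BVE mul_row_col mul0mx add0r mulKmx.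
  rewrite [X in is_derive _ _ X _]zBV.
  apply: (is_derive_eq (is_derive_mulmxl _ (dBV x x01))).
  rewrite dVE// [A *m _]mulmxA mul_block_lift /B /L mul_block_col.
  rewrite !mul0mx !add0r mulmx1 !mul_col_mx mul_row_col !mul0mx add0r.
  by rewrite -(mulmxA B22) mulKmx.
have [c zE] := linear_ode_col dz.
exists c => x x01; apply/eqP; rewrite -subr_eq; apply/eqP.
pose G (t : R) := V t - L *m (expint M t *m c).
have -> : U0 = G 0 by rewrite /G V0 expint0 mul0mx mulmx0 subr0.
have dEc (t : R) : is_derive t 1 (fun t => L *m (expint M t *m c))
    (L *m (expmx M t *m c)).
  exact/is_derive_mulmxl/is_derive_mulmxr/is_derive_expint.
apply: (@derive0_within_cst _ _ _ G 0 1) => // [t t01|].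
  have /derivableP := (dV t t01).1; rewrite -derive1E dVE// zE// => dVt.
  by apply: (is_derive_eq (is_deriveB dVt (dEc t))); rewrite subrr.
apply: (@within_continuousB _ R _ _ V (fun t => L *m (expint M t *m c))) => //.
by apply: continuous_subspaceT => s; exact: is_derive_continuous (dEc s).
Qed.

Lemma steady_uniquely_solvable_expint (U0 : 'cV[R]_(r + m)) (U1 : 'cV[R]_m) :
  expint M 1 \in unitmx -> steady_uniquely_solvable A B U0 U1.
Proof.
move=> E_unit.
have [c cE] : exists c, dsubmx U0 + expint M 1 *m c = U1.
  by exists (invmx (expint M 1) *m (U1 - dsubmx U0)); rewrite mulKVmx// addrC subrK.
exists (fun x => U0 + L *m (expint M x *m c)); split.
  rewrite -cE; apply: (@steady_solution_add U0 _ (fun=> U0)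
    (fun x => expint M x *m c) (fun x => expmx M x *m c)).
  - by move=> x; exact: is_derive_mulmxr (is_derive_expint M x).
  - by move=> x; rewrite mulmxA; exact: is_derive_mulmxr (is_derive_expmx M x).
  - by rewrite expint0 mul0mx.
  - exact: steady_solution_cst.
move=> V solV x x01; have [c' VE] := steady_solution_repr solV.
rewrite VE//; congr (_ + L *m (_ *m _)).
(* The condition at x = 1 determines [expint M 1 *m c'], hence c'. *)
apply: (can_inj (mulKmx E_unit)); apply: (addrI (dsubmx U0)); rewrite cE.
have [_ _ _ _ <-] := solV; rewrite VE ?ler01 ?lexx//.
by rewrite linearD/= mul_col_mx col_mxKd mul1mx.
Qed.

(** Adding to a solution a w that vanishes at 0 and 1 but not in between contradicts uniqueness; the
    data [U0] and [U1] are arbitrary. *)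
Lemma steady_not_uniquely_solvable (U0 : 'cV[R]_(r + m)) (U1 : 'cV[R]_m)
    (k : int) : k != 0 ->
  eigenvalue (map_mx (real_complex R) M) (0 +i* (2 * pi * k%:~R)) ->
  ~ steady_uniquely_solvable A B U0 U1.
Proof.
move=> k0 /real_eigencol[p [q]]; set b := 2 * pi * _ => -[Mp Mq pq0].
move=> [U [solU uniqU]].
have b0 : b != 0 by rewrite mulf_neq0 ?intr_eq0// gt_eqF// mulr_gt0 ?pi_gt0.
have p0 : p != 0.
  apply: contraTneq pq0 => p0; rewrite p0 eqxx/= negbK.
  have /eqP : - b *: q = 0 by rewrite -Mp p0 mulmx0.
  by rewrite scaler_eq0 oppr_eq0 (negPf b0).
(* [w t] is the real part of [(exp(i b t) - 1) (p + i q)]. *)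
pose w (t : R) := (cos (b * t) - 1) *: p - sin (b * t) *: q.
pose z (t : R) := (- b * sin (b * t)) *: p - (b * cos (b * t)) *: q.
have dw (t : R) : is_derive t 1 w (z t).
  apply: is_deriveB; apply: is_derive_scalemx; apply: trigger_derive;
    by rewrite /GRing.scale/=; ring.
have dz (t : R) : is_derive t 1 z (M *m z t).
  have -> : M *m z t =
      (- b * (b * cos (b * t))) *: p - (b * (- b * sin (b * t))) *: q.
    rewrite /z mulmxBr -!scalemxAr Mp Mq.
    by apply/matrixP => i j; rewrite !mxE; ring.
  apply: is_deriveB; apply: is_derive_scalemx; apply: trigger_derive;
    by rewrite /GRing.scale/=; ring.
have w0 : w 0 = 0 by rewrite /w mulr0 cos0 sin0 subrr !scale0r subrr.
have w1 : w 1 = 0.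
  by rewrite /w mulr1; have [-> ->] := cos_sin_2piM R k; rewrite subrr !scale0r subrr.
have := steady_solution_add dw dz w0 solU; rewrite w1 addr0 => /uniqU VU.
have kn0 : `|k%:~R : R| != 0 by rewrite normr_eq0 intr_eq0.
have kge1 : 1 <= `|k%:~R : R|.
  by rewrite -intr_norm -[1]/(1%:~R) ler_int -gtz0_ge1 normr_gt0.
(* Half a period of w: |bh| = pi, so w(h) = -2p, which is nonzero. As |k| >= 1, the point lies in
   [0, 1]. *)
pose h : R := (2 * `|k%:~R|)^-1.
have h_itv : 0 <= h <= 1.
  have k2 : 1 <= 2 * `|k%:~R : R| by lra.
  by rewrite invr_ge0 invf_le1 ?k2 ?(le_trans ler01 k2) ?(lt_le_trans ltr01 k2).
have bh : `|b * h| = pi.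
  rewrite normrM normfV !normrM normr_id !(ger0_norm (ler0n _ _)).
  by rewrite ger0_norm ?pi_ge0// invfM; field.
have cbh : cos (b * h) = -1 by rewrite -cos_norm bh cospi.
have sbh : sin (b * h) = 0 by apply: cos1sin0; rewrite cbh normrN1.
have := canRL (addKr (U h)) (VU h h_itv); rewrite addNr => /(congr1 dsubmx).
rewrite mul_col_mx col_mxKd mul1mx linear0 /w cbh sbh scale0r subr0 => /eqP.
by rewrite scaler_eq0 (negPf p0) orbF => /eqP; lra.
Qed.

End reduction.

Theorem proposition2p1 (R : realType) (n r : nat) (hrn : (r < n)%N)
  (* the system d_t f0(U) + f(U)_x = (Bf(U) U_x)_x on R^r x R^(n-r) *)
  (f0 f : 'cV[R]_(r + (n - r)) -> 'cV[R]_(r + (n - r)))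
  (Bf : 'cV[R]_(r + (n - r)) -> 'M[R]_(r + (n - r)))
  (A0 : 'cV[R]_(r + (n - r)) -> 'M[R]_(r + (n - r)))
  (A021 : 'cV[R]_(r + (n - r)) -> 'M[R]_(n - r, r))
  (A022 : 'cV[R]_(r + (n - r)) -> 'M[R]_(n - r))
  (hA0 : forall U, A0 U = block_mx 1%:M 0 (A021 U) (A022 U))
  (hf0 : forall U : 'cV[R]_(r + (n - r)), is_diff U f0 (mulmx (A0 U)))
  (hA0unit : forall U, A0 U \in unitmx)
  (hA022 : forall U, 0 < \det (A022 U))
  (* df and Bf are constant, with the given block structure *)
  (A B : 'M[R]_(r + (n - r)))
  (A11 : 'M[R]_r) (A12 : 'M[R]_(r, n - r))
  (A21 : 'M[R]_(n - r, r)) (A22 B22 : 'M[R]_(n - r))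
  (hA : A = block_mx A11 A12 A21 A22)
  (hf : forall U : 'cV[R]_(r + (n - r)), is_diff U f (mulmx A))
  (hB : B = block_mx 0 0 0 B22)
  (hBf : forall U, Bf U = B)
  (* assumptions (a), (b), (c) *)
  (ha_f : smooth f) (ha_B : smooth Bf)
  (hb : forall U, positive_spectrum
     (invmx (A022 U) *m B22 + (invmx (A022 U) *m B22)^T))
  (hc : positive_spectrum A11)
  (* boundary data *)
  (U0 : 'cV[R]_(r + (n - r))) (U1II : 'cV[R]_(n - r)) :
  steady_uniquely_solvable A B U0 U1II
  <-> spectrum (invmx B22 *m (A22 - A21 *m invmx A11 *m A12))
      `&` (@two_i_pi_Z R `\ 0) = set0.
Proof.
have A11_unit := positive_spectrum_unitmx hc.
(* Assumption (b) makes the product of the inverse of [A022 0] with [B22] invertible, hence both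
   factors. *)
have B22_unit : B22 \in unitmx.
  by have := sym_part_positive_unitmx (hb 0); rewrite unitmx_mul => /andP[].
rewrite hA hB; split=> [solvable | spec0].
  apply/seteqP; split=> // z [spec_z [[k _ zE] /eqP z0]].
  rewrite -{}zE in spec_z z0.
  have k0 : k != 0 by apply: contraNneq z0 => ->; rewrite mulr0.
  exact: steady_not_uniquely_solvable k0 spec_z solvable.
apply: steady_uniquely_solvable_expint => //; apply: expint1_unit => k eig_k.
apply/eqP; apply: contraT => k0.
suff : set0 (0 +i* (2 * pi * k%:~R) : R[i]) by [].
rewrite -spec0; split; first exact: eig_k.
split; first by exists k.
move=> [/eqP]; rewrite !mulf_eq0 intr_eq0 (negPf k0) orbF.
by rewrite pnatr_eq0 (gt_eqF (pi_gt0 R)).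
Qed.
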